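(* Let $\Gamma,\Delta$ be finite subsets of $For_2$ with $\Gamma\cup\Delta$ nonempty. If $\vDash_{\mathbf{B}_3}\Gamma\Rightarrow\Delta$, then $\Gamma\Rightarrow\Delta$ is provable in $\mathbf{B}$ without using the Cut rule. In particular, if $\Gamma\vDash_{\mathbf{B}_3}\alpha$ (with $\Gamma\cup\{\alpha\}$ finite) then $\Gamma\Rightarrow\alpha$ is provable in $\mathbf{B}$.
   Context: Fix a denumerable set $prop$ of propositional variables. $For_2$ is the set of formulas built from $prop$ with a unary connective $\lnot$ and a binary connective $\wedge$. $var(\alpha)$ is the set of propositional variables in $\alpha$; $var(\Gamma)=\bigcup_{\gamma\in\Gamma}var(\gamma)$. A sequent $\Gamma\Rightarrow\Delta$ is an ordered pair of finite sets of formulas, not both empty; $\alpha,\Gamma$ denotes $\Gamma\cup\{\alpha\}$. The calculus $\mathbf{B}$ has the axiom $\alpha\Rightarrow\alpha$ and the rules (premises / conclusion): (W$\Rightarrow$) $\Gamma\Rightarrow\Delta$ / $\alpha,\Gamma\Rightarrow\Delta$; ($\Rightarrow$W) $\Gamma\Rightarrow\Delta$ / $\Gamma\Rightarrow\Delta,\alpha$; (Cut) $\Gamma\Rightarrow\Delta,\alpha$ and $\alpha,\Gamma\Rightarrow\Delta$ / $\Gamma\Rightarrow\Delta$; ($\lnot\Rightarrow$) $\Gamma\Rightarrow\Delta,\alpha$ / $\lnot\alpha,\Gamma\Rightarrow\Delta$; ($\Rightarrow\lnot^B$) $\alpha,\Gamma\Rightarrow\Delta$ / $\Gamma\Rightarrow\Delta,\lnot\alpha$,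 allowed only if $var(\alpha)\subseteq var(\Gamma)$; ($\wedge\Rightarrow$) $\alpha_1,\alpha_2,\Gamma\Rightarrow\Delta$ / $\alpha_1\wedge\alpha_2,\Gamma\Rightarrow\Delta$; ($\Rightarrow\wedge$) $\Gamma\Rightarrow\Delta,\alpha_1$ and $\Gamma\Rightarrow\Delta,\alpha_2$ / $\Gamma\Rightarrow\Delta,\alpha_1\wedge\alpha_2$. Bochvar's logic $\mathbf{B}_3$ on $For_2$: truth values $\{1,\tfrac12,0\}$ with designated set $\{1\}$; valuations extend maps $prop\to\{1,\tfrac12,0\}$ by $\lnot1=0,\lnot\tfrac12=\tfrac12,\lnot0=1$, and $x\wedge y=\tfrac12$ if $x=\tfrac12$ or $y=\tfrac12$, otherwise classical conjunction. $\vDash_{\mathbf{B}_3}\Gamma\Rightarrow\Delta$ means: for every valuation $v$, if $v(\gamma)=1$ for all $\gamma\in\Gamma$ then $v(\delta)=1$ for some $\delta\in\Delta$. $\Gamma\vDash_{\mathbf{B}_3}\alpha$ means every valuation giving value $1$ to all of $\Gamma$ gives $1$ to $\alpha$. *)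

(* Defs.v *)
From HB Require Import structures.
From mathcomp Require Import all_boot finmap.

Set Implicit Arguments.
Unset Strict Implicit.
Unset Printing Implicit Defensive.

Local Open Scope fset_scope.

Definition denumerable (T : Type) : Prop := exists f : nat -> T, bijective f.

Inductive formula (prop : Type) : Type :=
| Var (p : prop)
| Neg (a : formula prop)
| And (a b : formula prop).

(* The encoding into GenTree.tree only serves to make formula prop a
   choiceType, so that {fset formula prop} makes sense. *)
Fixpoint formula_encode (prop : Type) (a : formula prop) : GenTree.tree prop :=
  match a with
  | Var p => GenTree.Leaf p
  | Neg a => GenTree.Node 0 [:: formula_encode a]
  | And a b => GenTree.Node 1 [:: formula_encode a; formula_encode b]
  end.

Fixpoint formula_decode (prop : Type) (t : GenTree.tree prop) :
    option (formula prop) :=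
  match t with
  | GenTree.Leaf p => Some (Var p)
  | GenTree.Node 0 [:: t] => omap (@Neg prop) (formula_decode t)
  | GenTree.Node 1 [:: t; u] =>
      if (formula_decode t, formula_decode u) is (Some a, Some b)
      then Some (And a b) else None
  | _ => None
  end.

Lemma formula_encodeK (prop : Type) :
  pcancel (@formula_encode prop) (@formula_decode prop).
Proof. by elim=> [p|a /= ->|a /= -> b /= ->]. Qed.

HB.instance Definition _ (prop : choiceType) :=
  Choice.copy (formula prop) (pcan_type (@formula_encodeK prop)).

Fixpoint var (prop : choiceType) (a : formula prop) : {fset prop} :=
  match a with
  | Var p => [fset p]
  | Neg a => var a
  | And a b => var a `|` var b
  end.

Definition varS (prop : choiceType) (G : {fset formula prop}) : {fset prop} :=
  \bigcup_(g <- G) var g.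

(* derivation G D is the type of derivations of the sequent G => D in B; the
   sides of a sequent are finite sets, so contraction is implicit, and in a rule
   the principal or active formula may already belong to the context.  As a
   sequent may not have both sides empty, Cut requires its conclusion to be
   nonempty; the conclusion of every other rule is automatically nonempty. *)
Inductive derivation (prop : choiceType) :
    {fset formula prop} -> {fset formula prop} -> Type :=
| Ax a :
    derivation [fset a] [fset a]
| WeakL a G D :
    derivation G D -> derivation (a |` G) D
| WeakR a G D :
    derivation G D -> derivation G (a |` D)
| Cut a G D :
    G `|` D != fset0 ->
    derivation G (a |` D) -> derivation (a |` G) D -> derivation G D
| NegL a G D :
    derivation G (a |` D) -> derivation (Neg a |` G) D
| NegR a G D :
    var a `<=` varS G ->
    derivation (a |` G) D -> derivation G (Neg a |` D)
| AndL a b G D :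
    derivation (a |` (b |` G)) D -> derivation (And a b |` G) D
| AndR a b G D :
    derivation G (a |` D) -> derivation G (b |` D) ->
    derivation G (And a b |` D).

Fixpoint cut_free (prop : choiceType) (G D : {fset formula prop})
    (d : derivation G D) : bool :=
  match d with
  | Ax _ => true
  | WeakL _ _ _ d => cut_free d
  | WeakR _ _ _ d => cut_free d
  | Cut _ _ _ _ _ _ => false
  | NegL _ _ _ d => cut_free d
  | NegR _ _ _ _ d => cut_free d
  | AndL _ _ _ _ d => cut_free d
  | AndR _ _ _ _ d1 d2 => cut_free d1 && cut_free d2
  end.

Definition provable (prop : choiceType) (G D : {fset formula prop}) : Prop :=
  inhabited (derivation G D).

Definition cut_free_provable (prop : choiceType)
    (G D : {fset formula prop}) : Prop :=
  exists d : derivation G D, cut_free d.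

(* The truth values 1, 1/2 and 0. *)
Inductive tv : Type := One | Half | Zero.

Definition tv_neg (x : tv) : tv :=
  match x with One => Zero | Half => Half | Zero => One end.

Definition tv_and (x y : tv) : tv :=
  match x, y with
  | Half, _ | _, Half => Half
  | One, One => One
  | _, _ => Zero
  end.

(* Valuations are represented by their restrictions v to the variables;
   eval v is the unique extension of v to all formulas. *)
Fixpoint eval (prop : Type) (v : prop -> tv) (a : formula prop) : tv :=
  match a with
  | Var p => v p
  | Neg a => tv_neg (eval v a)
  | And a b => tv_and (eval v a) (eval v b)
  end.

Definition B3_valid (prop : choiceType) (G D : {fset formula prop}) : Prop :=
  forall v : prop -> tv,
    (forall g, g \in G -> eval v g = One) ->
    exists2 d, d \in D & eval v d = One.

Definition B3_entails (prop : choiceType) (G : {fset formula prop})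
    (a : formula prop) : Prop :=
  forall v : prop -> tv,
    (forall g, g \in G -> eval v g = One) -> eval v a = One.

(* Main.v *)
(** A valuation satisfying [Gamma] is classical on [varS Gamma]; giving the value
    1/2 to all other variables shows that validity in B3 only depends on the
    formulas of [Delta] whose variables occur in [Gamma], and that the sequent
    restricted to these is classically valid.  Backward proof search in the
    classical calculus then succeeds: since sides of sequents are sets, each rule
    can keep its principal formula, so the variables of the left side never
    decrease and the proviso of [NegR] always holds. *)

Require Import Defs.
From mathcomp Require Import all_boot finmap.
Local Open Scope fset_scope.

Section CutFreeCompleteness.
Set Implicit Arguments.
Unset Strict Implicit.

Variable prop : choiceType.
Implicit Types (a b : formula prop) (G D : {fset formula prop}).

Lemma var_sub_varS a G : a \in G -> var a `<=` varS G.
Proof. by move=> aG; apply: (bigfcup_sup _ aG). Qed.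

Lemma varS_sub_fset1U a G : varS G `<=` varS (a |` G).
Proof.
apply/bigfcupsP => g gG _; apply: var_sub_varS.
by rewrite in_fset1U gG orbT.
Qed.

(** Inserting a principal formula that is already present changes nothing, so each logical rule can
    be read backwards with its principal formula kept in the premises; likewise in the next three
    lemmas. *)
Lemma cut_free_NegL a G D : Neg a \in G ->
  cut_free_provable G (a |` D) -> cut_free_provable G D.
Proof.
by move=> aG [d dP]; rewrite -(mem_fset1U aG); exists (NegL d).
Qed.

Lemma cut_free_NegR a G D : Neg a \in D -> var a `<=` varS G ->
  cut_free_provable (a |` G) D -> cut_free_provable G D.
Proof.
by move=> aD aG [d dP]; rewrite -(mem_fset1U aD); exists (NegR aG d).
Qed.

Lemma cut_free_AndL a b G D : And a b \in G ->
  cut_free_provable (a |` (b |` G)) D -> cut_free_provable G D.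
Proof.
by move=> abG [d dP]; rewrite -(mem_fset1U abG); exists (AndL d).
Qed.

Lemma cut_free_AndR a b G D : And a b \in D ->
  cut_free_provable G (a |` D) -> cut_free_provable G (b |` D) ->
  cut_free_provable G D.
Proof.
move=> abD [d dP] [e eP]; rewrite -(mem_fset1U abD).
by exists (AndR d e); rewrite /= dP eP.
Qed.

Lemma cut_free_Ax a G D : a \in G -> a \in D -> cut_free_provable G D.
Proof.
move=> /mem_fset1U <- /mem_fset1U <-; rewrite ![a |` _]fsetUC.
elim/fset1U_rect: G => [|x G _ [d dP]]; last first.
  by rewrite -fsetUA; exists (WeakL x d).
elim/fset1U_rect: D => [|y D _ [d dP]]; last first.
  by rewrite -fsetUA; exists (WeakR y d).
by rewrite fset0U; exists (Ax a).
Qed.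

(** Atoms count 1, so that discarding an atom from a list also lowers the total size. *)
Fixpoint fsize a : nat :=
  match a with
  | Var _ => 1
  | Neg a => (fsize a).+1
  | And a b => (fsize a + fsize b).+1
  end.

Definition seq_size (s : seq (formula prop)) : nat := sumn (map fsize s).

Fixpoint ceval (v : prop -> bool) a : bool :=
  match a with
  | Var p => v p
  | Neg a => ~~ ceval v a
  | And a b => ceval v a && ceval v b
  end.

(** [L] and [R] are the formulas still to be decomposed; the decomposed ones stay
    in [G] and [D], where only the atoms matter for the semantics. *)
Lemma cut_free_search (L R : seq (formula prop)) G D :
  {subset L <= G} -> {subset R <= D} ->
  (forall r, r \in R -> var r `<=` varS G) ->
  (forall v : prop -> bool,
     all (ceval v) L -> (forall p, Var p \in G -> v p) ->
     has (ceval v) R \/ exists2 p, Var p \in D & v p) ->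
  cut_free_provable G D.
Proof.
(* [G] and [D] only grow, so the induction is on what remains to be decomposed. *)
have [n] := ubnP (seq_size L + seq_size R).
elim: n L R G D => // n IHn L R G D szLR subL subR varR valid.
have varRU x r : r \in R -> var r `<=` varS (x |` G).
  by move=> /varR rG; exact: fsubset_trans rG (varS_sub_fset1U x G).
case: L => [|[p|a|a b] L] in szLR subL valid *; last first.
- have [abG subL'] : And a b \in G /\ {subset L <= G}.
    by split=> [|x xL]; apply: subL; rewrite inE ?eqxx ?xL ?orbT.
  apply: (cut_free_AndL abG); apply: (IHn [:: a, b & L] R) => //.
  + by move: szLR; rewrite /seq_size /= !addSn !addnA.
  + move=> x; rewrite !inE => /or3P[->|->|/subL' ->]; by rewrite ?orbT.
  + move=> r rR; apply: fsubset_trans (varS_sub_fset1U _ _); exact: varRU.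
  + move=> v /= /and3P[va vb vL] vG; apply: valid => [|p pG].
      by rewrite /= va vb.
    by apply: vG; rewrite !in_fset1U pG !orbT.
- have [aG subL'] : Neg a \in G /\ {subset L <= G}.
    by split=> [|x xL]; apply: subL; rewrite inE ?eqxx ?xL ?orbT.
  apply: (cut_free_NegL aG); apply: (IHn L (a :: R)) => //.
  + by move: szLR; rewrite /seq_size /= addSn addnCA addnA.
  + by move=> x; rewrite !inE => /orP[->|/subR ->]; rewrite ?orbT.
  + by move=> r; rewrite inE => /orP[/eqP ->|/varR //]; exact: var_sub_varS aG.
  (* Either [a] is itself a true formula of the new right list, or [Neg a] is true and [valid]
     applies. *)
  + move=> v vL vG /=; case va: (ceval v a); first by left.
    case: (valid v _ vG) => [|vR|[p pD vp]]; first by rewrite /= va.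
      by left.
    by right; exists p => //; rewrite in_fset1U pD orbT.
- have [pG subL'] : Var p \in G /\ {subset L <= G}.
    by split=> [|x xL]; apply: subL; rewrite inE ?eqxx ?xL ?orbT.
  (* An atom is merely dropped from [L]: it stays in [G], which already forces [v p]. *)
  apply: (IHn L R) => // v vL vG; apply: valid => //=.
  by rewrite vG.
case: R => [|[p|a|a b] R] in szLR subR varR varRU valid *; last first.
- have [abD subR'] : And a b \in D /\ {subset R <= D}.
    by split=> [|x xR]; apply: subR; rewrite inE ?eqxx ?xR ?orbT.
  have /= := varR _ (mem_head _ _); rewrite fsubUset => /andP[aG bG].
  (* This serves both premises of [AndR], with a conjunct [c] replacing [And a b] in the list. *)
  have step c : fsize c < fsize (And a b) -> var c `<=` varS G ->
      (forall v, ceval v (And a b) -> ceval v c) ->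
      cut_free_provable G (c |` D).
    move=> szc cG abc; apply: (IHn [::] (c :: R)) => //.
    + by rewrite ltnS in szLR; apply: leq_trans szLR; rewrite /seq_size /= !add0n ltn_add2r.
    + by move=> x; rewrite !inE => /orP[->|/subR' ->]; rewrite ?orbT.
    + by move=> r; rewrite inE => /orP[/eqP ->|rR] //; apply: varR; rewrite inE rR orbT.
    + move=> v vL vG; case: (valid v vL vG) => [/orP[/abc vc|vR]|[p pD vp]].
      * by left; rewrite /= vc.
      * by left; apply/orP; right.
      * by right; exists p => //; rewrite in_fset1U pD orbT.
  apply: (cut_free_AndR abD); apply: step => //=.
  + by rewrite ltnS leq_addr.
  + by move=> v /andP[].
  + by rewrite ltnS leq_addl.
  + by move=> v /andP[].
- have [aD subR'] : Neg a \in D /\ {subset R <= D}.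
    by split=> [|x xR]; apply: subR; rewrite inE ?eqxx ?xR ?orbT.
  apply: (cut_free_NegR aD); first exact: varR (mem_head _ _).
  apply: (IHn [:: a] R) => //.
  + by move: szLR; rewrite /seq_size /= addn0 addSn.
  + by move=> x; rewrite !inE => ->.
  + by move=> r rR; apply: varRU; rewrite inE rR orbT.
  + move=> v /=; rewrite andbT => va vG.
    case: (valid v) => [//|p pG||]; [| |by right].
      by apply: vG; rewrite in_fset1U pG orbT.
    by rewrite /= va; left.
- have [pD subR'] : Var p \in D /\ {subset R <= D}.
    by split=> [|x xR]; apply: subR; rewrite inE ?eqxx ?xR ?orbT.
  apply: (IHn [::] R) => //.
  + by move=> r rR; apply: varR; rewrite inE rR orbT.
  + move=> v vL vG; case: (valid v vL vG) => [/orP[vp|vR]|]; [|by left|by right].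
    by right; exists p.
(* Both lists are empty: the valuation true exactly at the atoms of [G] yields an atom common to [G]
   and [D]. *)
have [] := valid (fun p => Var p \in G); [by []|by []|by []|move=> [p pD pG]].
exact: (cut_free_Ax pG pD).
Qed.

Definition tv_on (V : {fset prop}) (v : prop -> bool) (p : prop) : tv :=
  if p \in V then if v p then One else Zero else Half.

(** The value 1/2 is infectious: one variable outside [V] gives it to the whole formula, while on
    values 1 and 0 the connectives are classical. *)
Lemma eval_tv_on (V : {fset prop}) (v : prop -> bool) a :
  eval (tv_on V v) a =
    if var a `<=` V then if ceval v a then One else Zero else Half.
Proof.
elim: a => [p|a /= ->|a /= -> b /= ->] /=.
- by rewrite fsub1set.
- by case: ifP => //; case: ifP.
- by rewrite fsubUset; do 2![case: (_ `<=` _)]; do 2![case: (ceval _ _)].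
Qed.

Lemma B3_valid_cut_free G D : B3_valid G D -> cut_free_provable G D.
Proof.
move=> valid; pose V := varS G.
(* All of [G] is to be decomposed, but of [D] only the formulas that meet the proviso of [NegR]. *)
apply: (@cut_free_search G [seq d <- D | var d `<=` V]) => //.
- by move=> d; rewrite mem_filter => /andP[].
- by move=> d; rewrite mem_filter => /andP[].
move=> v /allP vG _; left; apply/hasP.
have [g gG|d dD] := valid (tv_on V v).
  by rewrite eval_tv_on var_sub_varS // vG.
(* Having value 1 rather than 1/2, [d] has all its variables in [V] and so survives the filter. *)
rewrite eval_tv_on; case: ifP => // dV; case: ifP => // vd _.
by exists d => //; rewrite mem_filter dV.
Qed.

End CutFreeCompleteness.

Theorem mainTheorem5 (prop : choiceType) (prop_denum : denumerable prop) :
  (forall Gamma Delta : {fset formula prop},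
     Gamma `|` Delta != fset0 ->
     B3_valid Gamma Delta -> cut_free_provable Gamma Delta) /\
  (forall (Gamma : {fset formula prop}) (alpha : formula prop),
     B3_entails Gamma alpha -> provable Gamma [fset alpha]).
Proof.
split=> [Gamma Delta _|Gamma alpha entails]; first exact: B3_valid_cut_free.
have [|d _] := @B3_valid_cut_free _ Gamma [fset alpha]; last by exists.
by move=> v vG; exists alpha; [rewrite in_fset1|exact: entails].
Qed.
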